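(* Let $R$ be a commutative ring and let $M_n(R)$ be the ring of $n\times n$ matrices with entries from $R$. Let $\{N_1, N_2, \ldots, N_k\}$ be a collection of ideals of $R$ satisfying the CNC-condition, and let $s_i$ be the characteristic of the ideal $N_i$ in the ideal $N_{i+1}$ for $i=1,\dots,k-1$. Let $f=[f_{ij}]\in M_n(R)$. Then $\overline{f}=[f_{ij}+N_1]$ is an invertible element of the matrix ring $M_n(R/N_1)$ if and only if $f+M_n(N_1)\subset (M_n(R))^{\ast}$. Furthermore, in this case, for each $x\in f+M_n(N_1)$, \[x^{-1}=g(xg)^{s_1s_2\cdots s_{k-1}-1},\] where $g=[g_{ij}]\in M_n(R)$ is any matrix such that $\overline{f}\,\overline{g}=\overline{I}$ in $M_n(R/N_1)$, with $I$ the identity matrix. Moreover, \[|(M_n(R))^{\ast}|=|(M_n(R/N_1))^{\ast}|\,|N_1|^{n^2}.\]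
   Context: Rings are associative with identity $1$. For a ring $A$, $A^{\ast}$ denotes its group of invertible elements. $M_n(N_1)$ denotes the ideal of $M_n(R)$ of matrices with all entries in $N_1$, and $\overline{g}=[g_{ij}+N_1]$ for $g=[g_{ij}]\in M_n(R)$. A collection $\{N_1,\dots,N_k\}$ of ideals of a ring $R$ satisfies the CNC-condition if: (1) (chain condition) $\{0\}=N_k\subset N_{k-1}\subset\cdots\subset N_2\subset N_1\subset R$; (2) (nilpotency condition) for $i=1,\dots,k-1$ there exists an integer $t_i\geq 2$ such that $N_i^{t_i}\subset N_{i+1}$; (3) (characteristic condition) for $i=1,\dots,k-1$ there exists an integer $s_i\geq 1$ such that $s_iN_i\subset N_{i+1}$, and all prime factors of $s_i$ are greater than or equal to $t_i$. The minimum $t_i$ satisfying the nilpotency condition is called the nilpotency index of $N_i$ in $N_{i+1}$; the minimum $s_i$ satisfying the characteristic condition is called the characteristic of $N_i$ in $N_{i+1}$. *)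

(* Defs.v *)
From HB Require Import structures.
From mathcomp Require Import all_boot all_order all_algebra.
From mathcomp Require Import mathcomp_extra boolp classical_sets functions cardinality.

Set Implicit Arguments.
Unset Strict Implicit.
Unset Printing Implicit Defensive.

Import GRing.Theory.

#[local] Set Warnings "-redundant-canonical-projection".

Local Open Scope ring_scope.
Local Open Scope quotient_scope.
Local Open Scope classical_set_scope.

(** ** Ideals and quotients of a commutative ring

  The library's [idealr] and its ring structure on [{ideal_quot I}] need a
  nonzero ring and a proper ideal. Neither is assumed here: the zero ring and
  the improper ideal are allowed. *)

HB.mixin Record isIdeal (R : comPzRingType) (S : R -> bool) := {
  ideal_mull : forall a : R, {in S, forall u, a * u \in S}
}.

#[short(type="ideal")]
HB.structure Definition Ideal (R : comPzRingType) :=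
  {S of GRing.ZmodClosed R S & isIdeal R S}.

(* The carrier R/I and its additive group are the library's; the alias carries
   the multiplication. *)
Definition quotient_ring (R : comPzRingType) (I : ideal R) : Type :=
  {ideal_quot I}.

Section QuotientRing.
Variables (R : comPzRingType) (I : ideal R).
Local Notation Q := (quotient_ring I).

HB.instance Definition _ := GRing.Zmodule.on Q.

Definition residue (x : R) : Q := \pi_({ideal_quot I}) x.

Definition quotient_one : Q := residue 1.
Definition quotient_mul (u v : Q) : Q :=
  residue (repr (u : {ideal_quot I}) * repr (v : {ideal_quot I})).

Lemma residueP (x y : R) : residue x = residue y <-> x - y \in I.
Proof.
split=> [/eqP h | h].
  by rewrite (Quotient.idealrBE I).
by apply/eqP; rewrite -(Quotient.idealrBE I).
Qed.

Lemma residue_surj (u : Q) : exists x, u = residue x.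
Proof. by exists (repr (u : {ideal_quot I})); rewrite /residue reprK. Qed.

Lemma residueD (x y : R) : residue (x + y) = residue x + residue y.
Proof. exact: (raddfD \pi_({ideal_quot I})). Qed.

Lemma residueM (x y : R) : residue (x * y) = quotient_mul (residue x) (residue y).
Proof.
apply/residueP; set x' := repr _; set y' := repr _.
have hx : x - x' \in I by apply/residueP; rewrite /residue reprK.
have hy : y - y' \in I by apply/residueP; rewrite /residue reprK.
have -> : x * y - x' * y' = y * (x - x') + x' * (y - y').
  by rewrite !mulrBr addrA (mulrC y x) (mulrC y x') subrK.
by rewrite rpredD ?ideal_mull.
Qed.

Fact quotient_mulA : associative quotient_mul.
Proof.
move=> u v w; have [[x ->] [y ->] [z ->]] :=
  And3 (residue_surj u) (residue_surj v) (residue_surj w).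
by rewrite -!residueM mulrA.
Qed.

Fact quotient_mulC : commutative quotient_mul.
Proof.
move=> u v; have [[x ->] [y ->]] := conj (residue_surj u) (residue_surj v).
by rewrite -!residueM mulrC.
Qed.

Fact quotient_mul1 : left_id quotient_one quotient_mul.
Proof. by move=> u; have [x ->] := residue_surj u; rewrite -residueM mul1r. Qed.

Fact quotient_mulDl : left_distributive quotient_mul +%R.
Proof.
move=> u v w; have [[x ->] [y ->] [z ->]] :=
  And3 (residue_surj u) (residue_surj v) (residue_surj w).
by rewrite -residueD -!residueM -residueD mulrDl.
Qed.

HB.instance Definition _ := GRing.Zmodule_isComPzRing.Build Q
  quotient_mulA quotient_mulC quotient_mul1 quotient_mulDl.

Fact residue_is_zmod_morphism : zmod_morphism residue.
Proof. exact: (raddfB \pi_({ideal_quot I})). Qed.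

Fact residue_is_monoid_morphism : monoid_morphism residue.
Proof. by split=> [|x y]; last exact: residueM. Qed.

HB.instance Definition _ :=
  GRing.isZmodMorphism.Build R Q residue residue_is_zmod_morphism.
HB.instance Definition _ :=
  GRing.isMonoidMorphism.Build R Q residue residue_is_monoid_morphism.

End QuotientRing.

(** ** Invertible elements *)

(* Uniqueness of inverses makes [is_inverse x y] the relation x^-1 = y; no
   unit ring structure is assumed. *)
Definition is_inverse (A : pzRingType) (x y : A) : Prop := x * y = 1 /\ y * x = 1.

Definition units {A : pzRingType} : set A := [set x | exists y, is_inverse x y].

(** ** Matrices over an ideal *)

Definition mx_ideal (R : comPzRingType) (I : ideal R) (n : nat) : set 'M[R]_n :=
  [set m | forall i j, m i j \in I].
Arguments mx_ideal {R} I n _.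

Definition mx_coset (R : comPzRingType) (I : ideal R) (n : nat) (f : 'M[R]_n) :
    set 'M[R]_n :=
  [set f + m | m in mx_ideal I n].

Definition mx_residue (R : comPzRingType) (I : ideal R) (n : nat) (f : 'M[R]_n) :
    'M[quotient_ring I]_n :=
  map_mx (@residue R I) f.

Definition mx_units (R : comPzRingType) (n : nat) : set 'M[R]_n := units.
Arguments mx_units R n _ : clear implicits.

(** ** The CNC-condition *)

(* I^t for t >= 1: the finite sums of products of t elements of I. *)
Definition ideal_power (R : comPzRingType) (I : ideal R) (t : nat) : set R :=
  [set x | exists (m : nat) (a : 'I_m -> 'I_t -> R),
     (forall i j, a i j \in I) /\ x = \sum_(i < m) \prod_(j < t) a i j].

Definition nilpotency_condition (R : comPzRingType) (I J : ideal R) (t : nat) :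
    Prop :=
  (2 <= t)%N /\ (forall x, ideal_power I t x -> x \in J).

Definition characteristic_condition (R : comPzRingType) (I J : ideal R)
    (t s : nat) : Prop :=
  [/\ (1 <= s)%N,
      (forall x, x \in I -> x *+ s \in J) &
      (forall p : nat, prime p -> (p %| s)%N -> (t <= p)%N)].

(* The ideals are N 1, ..., N k; the values of N at other indices are
   irrelevant. All inclusions are non-strict, and N 1 may be R itself. *)
Definition CNC (R : comPzRingType) (k : nat) (N : nat -> ideal R) : Prop :=
  [/\ (1 <= k)%N,
      (forall x : R, (x \in N k) = (x == 0)),
      (forall i, (1 <= i < k)%N -> {subset N i.+1 <= N i}) &
      (forall i, (1 <= i < k)%N -> exists t s,
         nilpotency_condition (N i) (N i.+1) t /\
         characteristic_condition (N i) (N i.+1) t s)].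

(* The bound on the prime factors of s refers to an exponent t satisfying the
   nilpotency condition. *)
Definition admissible_characteristic (R : comPzRingType) (I J : ideal R)
    (s : nat) : Prop :=
  exists t, nilpotency_condition I J t /\ characteristic_condition I J t s.

Definition is_characteristic (R : comPzRingType) (I J : ideal R) (s : nat) :
    Prop :=
  admissible_characteristic I J s /\
  (forall s', admissible_characteristic I J s' -> (s <= s')%N).

(* Main.v *)
Require Import Defs.
From HB Require Import structures.
From mathcomp Require Import all_boot all_order all_algebra.
From mathcomp Require Import mathcomp_extra boolp classical_sets functions cardinality.

(** Write [y = x * g], where [g] inverts [f] modulo [N 1] and [x] lies in the
  coset of [f].  Then [y] is congruent to [1] modulo [N 1], and the proposition
  follows from the identity [y ^+ (s 1 * ... * s (k - 1)) = 1]: it makes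
  [g * y ^+ (s 1 * ... * s (k - 1) - 1)] a right inverse of [x], and the same
  identity for [g * x] makes it a left inverse.

  The identity is reached one ideal at a time: raising to the power [s i] turns
  a congruence [y = 1] modulo [N i] into one modulo [N i.+1]
  ([congr_one_expr]).  Indeed, in the binomial expansion of [(1 + a) ^+ s] with
  [a] over [N i], the terms of degree at least [t] vanish by nilpotency
  ([mx_residue_nilpotent]), and those of degree [j] between [0] and [t] have a
  coefficient divisible by [s], because no prime factor of [s] is small enough
  to divide [j] ([dvdn_bin_prime_ge]).  Since [N k] is zero, the last congruence
  is an equality ([mx_expr_prod_eq1]).

  Hence a matrix is invertible exactly when its residue modulo [N 1] is
  ([mx_units_residue]), so the units of the matrix ring form the preimage of
  the units of the quotient.  Every fibre of the reduction is a coset of the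
  matrices over [N 1], which gives the cardinality
  ([card_preimage_mx_residue]). *)

Set Implicit Arguments.
Unset Strict Implicit.
Unset Printing Implicit Defensive.

Import GRing.Theory.

Local Open Scope ring_scope.
Local Open Scope classical_set_scope.
Local Open Scope card_scope.

(** The identity [j * 'C(s, j) = s * 'C(s.-1, j.-1)] shows that [s] divides
  [j * 'C(s, j)]; as the prime factors of [j] are at most [j], hence below
  those of [s], the factor [j] is coprime to [s] and cancels. *)
Lemma dvdn_bin_prime_ge (s t j : nat) :
  (0 < s)%N -> (forall p, prime p -> (p %| s)%N -> (t <= p)%N) ->
  (0 < j < t)%N -> (s %| 'C(s, j))%N.
Proof.
move=> s0 hs /andP[j0 jt].
have cop : coprime s j.
  rewrite coprime_has_primes //; apply/hasPn => p.
  rewrite !mem_primes => /and3P[pp _ pj]; apply/negP => /and3P[_ _ ps].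
  have := leq_trans jt (hs p pp ps).
  by rewrite ltnNge dvdn_leq.
case: j => // j in j0 jt cop *.
by rewrite -(Gauss_dvdr _ cop) -mul_bin_diag dvdn_mulr.
Qed.

Section IdealPower.
Variables (R : comPzRingType) (I : ideal R).

Lemma ideal_powerD (t : nat) (x y : R) :
  ideal_power I t x -> ideal_power I t y -> ideal_power I t (x + y).
Proof.
move=> [m1 [a1 [h1 ->]]] [m2 [a2 [h2 ->]]].
exists (m1 + m2)%N, (fun i =>
  match fintype.split i with inl u => a1 u | inr v => a2 v end).
split=> [i j|]; first by case: (fintype.split i).
rewrite big_split_ord; congr (_ + _); apply: eq_bigr => i _.
  by rewrite (unsplitK (inl i)).
by rewrite (unsplitK (inr i)).
Qed.

Lemma ideal_power0 (t : nat) : ideal_power I t 0.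
Proof.
exists 0%N, (fun _ _ => 0); split=> [[]//|].
by rewrite big_ord0.
Qed.

Lemma ideal_power1 : ideal_power I 0 1.
Proof.
exists 1%N, (fun _ _ => 0); split=> [i []//|].
by rewrite big_ord1 big_ord0.
Qed.

Lemma ideal_powerS (t : nat) (x y : R) :
  x \in I -> ideal_power I t y -> ideal_power I t.+1 (x * y).
Proof.
move=> xI [m [a [h ->]]].
exists m, (fun i j => if unlift ord0 j is Some j' then a i j' else x).
split=> [i j|]; first by case: unliftP.
rewrite mulr_sumr; apply: eq_bigr => i _.
rewrite big_ord_recl unlift_none; congr (_ * _).
by apply: eq_bigr => j _; rewrite liftK.
Qed.

(** Starting the induction at [t = 0] works because the formula for
  [ideal_power] then gives the natural multiples of [1], which contain the entries of
  the identity matrix. *)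
Lemma mx_expr_ideal_power (n t : nat) (a : 'M[R]_n) (i j : 'I_n) :
  Defs.mx_ideal I n a -> ideal_power I t ((a ^+ t) i j).
Proof.
move=> aI; elim: t i j => [|t IH] i j.
  rewrite expr0 mxE; case: (i == j); last exact: ideal_power0.
  exact: ideal_power1.
rewrite exprS mxE; elim/big_rec: _ => [|l y _ hy]; first exact: ideal_power0.
by apply: ideal_powerD => //; apply: ideal_powerS.
Qed.

End IdealPower.

Section Residue.
Variables (R : comPzRingType) (I : ideal R) (n : nat).
Implicit Types (a f g x : 'M[R]_n).

(* Gives [mx_residue] the ring morphism structure of [map_mx]. *)
HB.instance Definition _ :=
  GRing.RMorphism.copy (@mx_residue R I n) (map_mx (@residue R I)).

Lemma residue_eq0 (x : R) : (residue I x = 0) <-> (x \in I).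
Proof. by rewrite -(raddf0 (residue I)) residueP subr0. Qed.

Lemma mx_residue_eq0 a : mx_residue I a = 0 <-> Defs.mx_ideal I n a.
Proof.
split=> [/matrixP h i j | h].
  by apply/residue_eq0; have := h i j; rewrite !mxE.
by apply/matrixP => i j; rewrite !mxE; apply/residue_eq0/h.
Qed.

Lemma mx_cosetP f x : mx_coset I f x <-> mx_residue I x = mx_residue I f.
Proof.
split=> [[m mI <-] | h].
  by rewrite raddfD /= (mx_residue_eq0 m).2 // addr0.
exists (x - f); last by rewrite addrC subrK.
by apply/mx_residue_eq0; rewrite raddfB /= h subrr.
Qed.

(** The entrywise set of representatives is only a set-theoretic section. *)
Definition mx_lift (u : 'M[quotient_ring I]_n) : 'M[R]_n :=
  map_mx (fun q => repr (q : {ideal_quot I})%type) u.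

Lemma mx_liftK : cancel mx_lift (@mx_residue R I n).
Proof. by move=> u; apply/matrixP => i j; rewrite !mxE /residue reprK. Qed.

(** The coordinates of a matrix with residue [u] are [u] itself and its
  difference with the chosen lift of [u], which has entries in [I]. *)
Lemma card_preimage_mx_residue (V : set 'M[quotient_ring I]_n) :
  (@mx_residue R I n) @^-1` V #=
    V `*` [set: {ffun 'I_(n ^ 2) -> {a : R | a \in I}}].
Proof.
pose d x := x - mx_lift (mx_residue I x).
have dI x : Defs.mx_ideal I n (d x).
  by apply/mx_residue_eq0; rewrite raddfB /= mx_liftK subrr.
have vI x (p : 'I_(n * n)) : mxvec (d x) 0 p \in I.
  by case/mxvec_indexP: p => i j; rewrite mxvecE; apply: dI.
(* The exponent [n ^ 2] is convertible to [n * n], the size of [mxvec]. *)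
pose F x : 'M[quotient_ring I]_n * {ffun 'I_(n ^ 2) -> {a : R | a \in I}} :=
  (mx_residue I x, [ffun p : 'I_(n * n) => exist (fun a : R => a \in I) _ (vI x p)]).
suff /bijPex[h] : exists F, set_bij ((@mx_residue R I n) @^-1` V)
    (V `*` [set: {ffun 'I_(n ^ 2) -> {a : R | a \in I}}]) F.
  exact: pcard_eq h.
exists F; split=> [x Vx | x y _ _ [exy /ffunP E] | [u c] [/= Vu _]].
- by split.
- have : d x = d y.
    apply: (can_inj mxvecK); apply/rowP => p.
    by have := E p; rewrite !ffunE => -[].
  by rewrite /d exy => /addIr.
- pose m : 'M[R]_n := vec_mx (\row_(p < n * n) sval (c p)).
  have mI : mx_residue I m = 0.
    by apply/mx_residue_eq0 => i j; rewrite !mxE; exact: (svalP (c _)).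
  have mu : mx_residue I (mx_lift u + m) = u.
    by rewrite raddfD /= mx_liftK mI addr0.
  exists (mx_lift u + m); first by rewrite /= mu.
  congr (_, _) => //; apply/ffunP => p; rewrite ffunE.
  apply: val_inj => /=.
  by rewrite /d mu addrC addKr vec_mxK mxE.
Qed.

End Residue.

Section CNCStep.
Variables (R : comPzRingType) (n : nat) (I J : ideal R) (t s : nat).
Hypothesis nilp : nilpotency_condition I J t.
Hypothesis charac : characteristic_condition I J t s.

Lemma mx_residue_nilpotent (j : nat) (a : 'M[R]_n) :
  Defs.mx_ideal I n a -> (t <= j)%N -> mx_residue J (a ^+ j) = 0.
Proof.
move=> aI /subnKC <-; rewrite exprD rmorphM /=.
rewrite (mx_residue_eq0 J (a ^+ t)).2 ?mul0r // => i l.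
exact/nilp.2/mx_expr_ideal_power.
Qed.

Lemma congr_one_expr (y : 'M[R]_n) :
  mx_residue I y = 1 -> mx_residue J (y ^+ s) = 1.
Proof.
case: charac => s0 sIJ hs y1.
pose a := y - 1.
have ra : mx_residue I a = 0 by rewrite raddfB /= y1 rmorph1 subrr.
have aI : Defs.mx_ideal I n a by apply/mx_residue_eq0.
rewrite -(subrK 1 y) -/a exprD1n big_ord_recl expr0 bin0 raddfD /= rmorph1.
rewrite raddf_sum big1 ?addr0 // => j _ /=.
have [tj | jt] := leqP t (bump 0 j).
  by rewrite raddfMn /= mx_residue_nilpotent // mul0rn.
have /dvdnP[q ->] : (s %| 'C(s, bump 0 j))%N.
  by apply: dvdn_bin_prime_ge hs _; rewrite ?jt.
rewrite mulnC mulrnA raddfMn /=.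
rewrite (mx_residue_eq0 J _).2 ?mul0rn // => i l.
rewrite mulmxnE; apply: sIJ.
apply: (mx_residue_eq0 I _).1.
by rewrite /bump /= exprS rmorphM /= ra mul0r.
Qed.

End CNCStep.

Section CNC.
Variables (R : comPzRingType) (n k : nat) (N : nat -> ideal R) (s : nat -> nat).
Hypothesis hN : CNC k N.
Hypothesis hs : forall i, (1 <= i < k)%N ->
  admissible_characteristic (N i) (N i.+1) (s i).
Local Notation S := (\prod_(1 <= i < k) s i)%N.

Lemma prod_characteristic_gt0 : (0 < S)%N.
Proof.
rewrite big_nat_cond prodn_cond_gt0 // => i; rewrite andbT => /hs.
by move=> [t [_ []]].
Qed.

Lemma mx_expr_prod_eq1 (y : 'M[R]_n) : mx_residue (N 1%N) y = 1 -> y ^+ S = 1.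
Proof.
move=> y1; case: hN => k1 Nk0 _ _.
have step i : (i < k)%N ->
    mx_residue (N i.+1) (y ^+ (\prod_(1 <= l < i.+1) s l)) = 1.
  elim: i => [|i IH] ik; first by rewrite big_geq // expr1.
  have [t [nilp charac]] := hs (i := i.+1) ik.
  rewrite big_nat_recr //= exprM.
  exact: congr_one_expr nilp charac _ (IH (ltnW ik)).
have kE : k = k.-1.+1 by rewrite prednK.
have := step k.-1; rewrite -kE leqnn => /(_ isT) h.
apply/eqP; rewrite -subr_eq0; apply/eqP/matrixP => i j.
rewrite [RHS]mxE; apply/eqP; rewrite -Nk0.
by apply: (mx_residue_eq0 (N k) _).1; rewrite raddfB /= h rmorph1 subrr.
Qed.

Lemma is_inverse_lift (x g : 'M[R]_n) :
  is_inverse (mx_residue (N 1%N) x) (mx_residue (N 1%N) g) ->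
  is_inverse x (g * (x * g) ^+ S.-1).
Proof.
move=> [xg gx]; have SE := prednK prod_characteristic_gt0.
(* Associativity moves [g] across the power; it converts the formula into the
   mirror one needed for the left inverse. *)
have shift m : g * (x * g) ^+ m = (g * x) ^+ m * g.
  elim: m => [|m IH]; first by rewrite !expr0 mulr1 mul1r.
  by rewrite exprSr mulrA IH exprSr !mulrA.
split; first by rewrite mulrA -exprS SE mx_expr_prod_eq1 // rmorphM.
by rewrite shift -mulrA -exprSr SE mx_expr_prod_eq1 // rmorphM.
Qed.

Lemma mx_units_residue (x : 'M[R]_n) :
  mx_units R n x <-> mx_units (quotient_ring (N 1%N)) n (mx_residue (N 1%N) x).
Proof.
split=> [[y [xy yx]] | [u]].
  by exists (mx_residue (N 1%N) y); split; rewrite -rmorphM ?xy ?yx rmorph1.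
rewrite -(mx_liftK u) => /is_inverse_lift.
by exists (mx_lift u * (x * mx_lift u) ^+ S.-1).
Qed.

End CNC.

Theorem proposition4p5 (R : comPzRingType) (n k : nat) (N : nat -> ideal R)
    (s : nat -> nat)
    (hN : CNC k N)
    (hs : forall i, (1 <= i < k)%N -> is_characteristic (N i) (N i.+1) (s i)) :
  (forall f : 'M[R]_n,
     (mx_units (quotient_ring (N 1%N)) n (mx_residue (N 1%N) f) <->
      mx_coset (N 1%N) f `<=` mx_units R n) /\
     (mx_units (quotient_ring (N 1%N)) n (mx_residue (N 1%N) f) ->
      forall x, mx_coset (N 1%N) f x ->
      forall g : 'M[R]_n,
        mx_residue (N 1%N) f * mx_residue (N 1%N) g = 1 ->
        is_inverse x (g * (x * g) ^+ (\prod_(1 <= i < k) s i).-1))) /\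
  mx_units R n #=
    mx_units (quotient_ring (N 1%N)) n `*`
    [set: {ffun 'I_(n ^ 2) -> {a : R | a \in N 1%N}}].
Proof.
have adm i : (1 <= i < k)%N -> admissible_characteristic (N i) (N i.+1) (s i).
  by move=> /hs[].
have unitE := mx_units_residue (n := n) hN adm.
split=> [f|]; last first.
  suff -> : mx_units R n =
      (@mx_residue R (N 1%N) n) @^-1` mx_units (quotient_ring (N 1%N)) n.
    exact: card_preimage_mx_residue.
  by apply/seteqP; split=> x /unitE.
split.
  split=> [fU x /mx_cosetP xf | fU]; first by apply/unitE; rewrite xf.
  by apply/unitE/fU/mx_cosetP.
move=> _ x /mx_cosetP xf g fg; apply: is_inverse_lift hN adm _ _ _.
by rewrite xf; split=> //; apply: mulmx1C.
Qed.
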